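(* Let $P\ge 1$ be the number of workers, and let the wallclock times taken by the workers to process a single mini-batch be i.i.d. positive random variables (across workers and across mini-batches) distributed as $X$, with $0<\mathbb{E}[X]<\infty$; let $X_1,\dots,X_P$ be i.i.d. copies of $X$. Then the ratio of the expected runtimes per iteration of synchronous SGD and asynchronous SGD is $$\frac{\mathbb{E}[T_{Sync}]}{\mathbb{E}[T_{Async}]}=P\,\frac{\mathbb{E}[X_{P:P}]}{\mathbb{E}[X]},$$ where $X_{P:P}$ is the $P$-th order statistic (the maximum) of $X_1,\dots,X_P$.
   Context: A central parameter server (PS) interacts with $P$ parallel workers. Each worker repeatedly computes the gradient on one mini-batch; computation times are i.i.d. copies of $X$ across workers and mini-batches. Everything other than computation takes zero time. An iteration is one update of the parameter at the PS; the expected runtime per iteration is the expected time between two consecutive updates. Synchronous SGD: at each iteration all $P$ workers start a fresh mini-batch simultaneously, and the PS updates when all $P$ of them have finished; then all workers start afresh. $T_{Sync}$ is the duration of one iteration. Asynchronous SGD: each worker, independently of the others, starts a new mini-batch as soon as it finishes (pushes) the previous one, and every push by any worker triggers one update at the PS. The expected runtime per iteration is understood in the limit of a large number of iterations: $\mathbb{E}[T_{Async}]=\lim_{J\to\infty}\mathbb{E}[S_J]/J$, where $S_J$ is the time of the $J$-th update (all workers starting at time $0$). *)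

(* Defs.v *)
From HB Require Import structures.
From mathcomp Require Import all_boot all_order all_algebra finmap.
From mathcomp Require Import all_classical all_reals all_analysis.

Set Implicit Arguments.
Unset Strict Implicit.
Unset Printing Implicit Defensive.

Import Order.TTheory GRing.Theory Num.Theory.
Import numFieldNormedType.Exports.

Local Open Scope classical_set_scope.
Local Open Scope card_scope.
Local Open Scope ring_scope.

Definition mutually_independent (d : measure_display) (T : measurableType d)
    (R : realType) (Pr : probability T R) (I : choiceType)
    (Y : I -> {RV Pr >-> R}) : Prop :=
  forall (F : {fset I}) (B : I -> set R), (forall i, measurable (B i)) ->
    Pr (\bigcap_(i in [set` F]) (Y i @^-1` B i)) =
    (\prod_(i <- F) Pr (Y i @^-1` B i))%E.

(* [distribution] is a total function on sets, hence the restriction to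
   measurable sets. *)
Definition same_distribution (d : measure_display) (T : measurableType d)
    (R : realType) (Pr : probability T R) (X Y : {RV Pr >-> R}) : Prop :=
  forall B : set R, measurable B -> distribution Pr X B = distribution Pr Y B.

(* No joint condition relates the family [Y] to [X] itself. *)
Definition iid_copies (d : measure_display) (T : measurableType d)
    (R : realType) (Pr : probability T R) (X : {RV Pr >-> R}) (I : choiceType)
    (Y : I -> {RV Pr >-> R}) : Prop :=
  mutually_independent Y /\ forall i, same_distribution (Y i) X.

(* Counted from 1: [order_stat v 1] is the minimum, [order_stat v n] the
   maximum. *)
Definition order_stat (R : realType) (n : nat) (v : 'I_n -> R) (k : nat) : R :=
  nth 0 (sort <=%R [seq v i | i : 'I_n]) k.-1.

(* In what follows [x i j] is the time that worker [i] takes on its [j]-th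
   mini-batch (counted from 0), along one sample path. *)

(* Time of the [k]-th update, with time 0 for [k = 0]: all workers start afresh
   at the previous update, and the last one to finish triggers the next. *)
Fixpoint sync_update_time (R : realType) (P : nat) (x : 'I_P -> nat -> R)
    (k : nat) : R :=
  if k is k'.+1 then
    let u := sync_update_time x k' in \big[Num.max/u]_(i < P) (u + x i k')
  else 0.

Definition sync_iteration (R : realType) (P : nat) (x : 'I_P -> nat -> R)
    (k : nat) : R :=
  sync_update_time x k.+1 - sync_update_time x k.

Definition push_time (R : realType) (P : nat) (x : 'I_P -> nat -> R)
    (i : 'I_P) (n : nat) : R :=
  \sum_(j < n.+1) x i j.

(* The first time by which at least [J] pushes have occurred; simultaneous
   pushes count as separate updates. *)
Definition async_update_time (R : realType) (P : nat) (x : 'I_P -> nat -> R)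
    (J : nat) : R :=
  inf [set t : R | 0 <= t /\
    `I_J #<= [set p : 'I_P * nat | push_time x p.1 p.2 <= t]].

Definition async_mean_runtime (d : measure_display) (T : measurableType d)
    (R : realType) (Pr : probability T R) (P : nat)
    (W : 'I_P * nat -> {RV Pr >-> R}) (J : nat) : \bar R :=
  ('E_Pr[fun w => async_update_time (fun i j => W (i, j) w) J] / J%:R%:E)%E.

(* Main.v *)
(* The [J]-th asynchronous update occurs when the pushes of the [P] workers
   reach [J] in total. With [m] the least integer such that [m P >= J], the
   pigeonhole principle puts it between the smallest and the largest of the
   times at which the workers finish their [m]-th mini-batch. By the law of
   large numbers in L1 (truncation, then Chebyshev) these are all [m E[X]] up to
   [o(m)] in mean, so that [E[S_J] / J] tends to [E[X] / P]. A synchronous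
   iteration lasts the maximum of [P] i.i.d. copies of [X], whose mean depends
   only on the law of [X]. *)

Require Import Defs.
From HB Require Import structures.
From mathcomp Require Import all_boot all_order all_algebra finmap.
From mathcomp Require Import all_classical all_reals all_analysis.
From mathcomp Require Import measurable_realfun.
From mathcomp Require Import ring lra.

Set Implicit Arguments.
Unset Strict Implicit.
Unset Printing Implicit Defensive.

Import Order.TTheory GRing.Theory Num.Theory.
Import numFieldNormedType.Exports.

Local Open Scope classical_set_scope.
Local Open Scope ring_scope.

(** * Almost everywhere comparison of integrals *)

Section IntegralNonmeasurable.
Local Open Scope ereal_scope.
Context d (T : measurableType d) (R : realType).
Variable mu : {measure set T -> \bar R}.
Implicit Types f g : T -> \bar R.

Import HBNNSimple.

(* The integral of a nonnegative function is the supremum of the integrals of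
   the simple functions below it, so its monotonicity needs no measurability. *)
Lemma ae_ge0_le_integral_nonmeas f g :
  (forall x, 0 <= f x) -> (forall x, 0 <= g x) ->
  {ae mu, forall x, f x <= g x} -> \int[mu]_x f x <= \int[mu]_x g x.
Proof.
move=> f0 g0 [N [mN muN fgN]].
rewrite !ge0_integralTE//; apply: ereal_sup_le => _ [h hf <-].
have mNC : measurable (~` N) by exact: measurableC.
(* Cut to zero on the exceptional null set [N], [h] lies below [g] everywhere and keeps its
   integral. *)
pose k := mul_nnsfun h (indic_nnsfun R mNC).
have kE x : k x = (h x * \1_(~` N) x)%R by [].
exists k => [x|].
  rewrite kE indicE.
  have [xN|xN] := boolP (x \in ~` N).
    rewrite mulr1 (le_trans (hf x))//; apply: contrapT => fg.
    by move: xN; rewrite inE => /(_ (fgN _ fg)).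
  by rewrite mulr0.
rewrite -!integralT_nnsfun; apply: ge0_ae_eq_integral => //.
- exact/measurable_EFinP.
- exact/measurable_EFinP.
- by move=> x _; rewrite lee_fin.
- by move=> x _; rewrite lee_fin.
- exists N; split => // x /= kh; apply: contrapT => xN; apply: kh => _.
  by rewrite /mindic indicE mem_set// mulr1.
Qed.

Lemma ae_eq_integral_nonmeas f g :
  {ae mu, forall x, f x = g x} -> \int[mu]_x f x = \int[mu]_x g x.
Proof.
move=> fg; rewrite [LHS]integralE [RHS]integralE.
by congr (_ - _); apply/eqP; rewrite eq_le; apply/andP; split;
  apply: ae_ge0_le_integral_nonmeas => //; apply: filterS fg => x;
  rewrite !(funeposE, funenegE) => ->.
Qed.

End IntegralNonmeasurable.

(** * Deterministic facts along one sample path *)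

Section Paths.
Context (R : realType) (P : nat).
Implicit Types (x : 'I_P -> nat -> R) (v : 'I_P -> R).

(** Translation by [u] commutes with [Num.max] and carries the default 0 to the default [u]. *)
Lemma sync_iterationE x k :
  sync_iteration x k = \big[Num.max/0]_(i < P) x i k.
Proof.
rewrite /sync_iteration /=; set u := sync_update_time x k.
have -> : \big[Num.max/u]_(i < P) (u + x i k) =
    u + \big[Num.max/0]_(i < P) x i k.
  rewrite (big_morph (+%R u) (id1 := u) (op1 := Num.max)) ?addr0//.
  by move=> a b; rewrite addr_maxr.
by rewrite addrC addKr.
Qed.

(** The last entry of the sorted list is one of the [v i] and dominates all of them; nonnegativity
    makes the default 0 of the big maximum harmless. *)
Lemma order_stat_max v : (0 < P)%N -> (forall i, 0 <= v i) ->
  order_stat v P = \big[Num.max/0]_(i < P) v i.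
Proof.
move=> P0 v0; rewrite /order_stat; set s := [seq v i | i : 'I_P].
have szs : size (sort <=%R s) = P by rewrite size_sort size_image card_ord.
apply/le_anti/andP; split.
  have : nth 0 (sort <=%R s) P.-1 \in s.
    by rewrite -(mem_sort <=%R) mem_nth// szs prednK.
  by move=> /mapP[i _ ->]; exact: le_bigmax.
apply: bigmax_le => [|i _].
  have : nth 0 (sort <=%R s) P.-1 \in s.
    by rewrite -(mem_sort <=%R) mem_nth// szs prednK.
  by move=> /mapP[i _ ->].
have : v i \in sort <=%R s by rewrite mem_sort map_f ?mem_enum.
move=> /(nthP 0)[j]; rewrite szs => jP <-.
apply: (sorted_leq_nth le_trans le_refl) => //.
- exact/sort_sorted/le_total.
- by rewrite inE szs.
- by rewrite inE szs prednK.
- by rewrite -ltnS prednK.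
Qed.

Lemma push_time_mono x i : (forall i j, 0 <= x i j) ->
  {homo push_time x i : m n / (m <= n)%N >-> m <= n}.
Proof.
move=> x0; apply: homo_leq => [//|? ? ?|n]; first exact: le_trans.
by rewrite /push_time [leRHS]big_ord_recr/= lerDl.
Qed.

(* [J.-1 %/ P] is the index, counted from 0, of the mini-batch number
   [ceil(J / P)]. When [J] pushes have occurred, some worker has completed it;
   when every worker has completed it, at least [J] pushes have occurred. *)
Lemma async_update_time_dist x (c D : R) J : (0 < P)%N -> (0 < J)%N ->
  (forall i j, 0 <= x i j) ->
  (forall i, `|push_time x i (J.-1 %/ P) - c| <= D) ->
  `|async_update_time x J - c| <= D.
Proof.
move=> P0 J0 x0; set m := (J.-1 %/ P)%N => xD.
rewrite ler_distl /async_update_time; set A := (X in inf X).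
have mxD i : c - D <= push_time x i m <= c + D by rewrite -ler_distl.
have push_ge0 i n : 0 <= push_time x i n by exact: sumr_ge0.
have AD : A (c + D).
  split.
    by have /andP[_] := mxD (Ordinal P0); exact: le_trans.
  (* Round-robin enumeration of pushes: for [k < J] the mini-batch index [k %/ P] is at most [m], so
     these [J] distinct pushes have all occurred by [c + D]. *)
  pose f k : 'I_P * nat := (Ordinal (ltn_pmod k P0), k %/ P)%N.
  have injf : {in `I_J &, injective f}.
    move=> j k _ _ [] jk1 jk2.
    by rewrite (divn_eq j P) (divn_eq k P) jk1 jk2.
  rewrite -(card_le_eql (inj_card_eq injf)).
  apply: subset_card_le => _ [k /= kJ <-] /=.
  have /andP[_] := mxD (Ordinal (ltn_pmod k P0)); apply: le_trans.
  apply: push_time_mono => //; apply: leq_div2r.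
  by rewrite -ltnS prednK.
have lbA : lbound A 0 by move=> t [].
apply/andP; split; last by apply: ge_inf => //; exists 0.
apply: lb_le_inf; first by exists (c + D).
move=> t [_ Jt]; rewrite leNgt; apply/negP => tcD.
(* Before [c - D] no worker has pushed its mini-batch of index [m], so at most [P * m] pushes have
   occurred, which is fewer than [J]. *)
suff : (`I_J #<= `I_(P * m))%card.
  rewrite card_le_II => JPm.
  have : (P * m <= J.-1)%N by rewrite mulnC leq_trunc_div.
  by move=> /(leq_trans JPm); rewrite -[X in (X <= _)%N]prednK// ltnn.
apply: card_le_trans Jt _.
pose f (p : 'I_P * nat) := (p.2 * P + p.1)%N.
have injf : {in [set p : 'I_P * nat | push_time x p.1 p.2 <= t] &, injective f}.
  move=> [i j] [k l] _ _; rewrite /f /= => e.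
  have e1 : i = k :> nat
    by have := congr1 (modn^~ P) e; rewrite !modnMDl !modn_small.
  move: e; rewrite e1 => /addIn/eqP; rewrite eqn_pmul2r// => /eqP ->.
  by congr pair; exact: val_inj.
rewrite -(card_le_eql (inj_card_eq injf)).
apply: subset_card_le => _ [[i n] /= it <-]; rewrite /f /=.
have nm : (n < m)%N.
  rewrite ltnNge; apply/negP => mn.
  have := push_time_mono i x0 mn; rewrite leNgt => /negP; apply.
  by rewrite (le_lt_trans it)// (lt_le_trans tcD)//; case/andP: (mxD i).
rewrite (@leq_trans (n.+1 * P)%N) ?mulSn ?[(P + _)%N]addnC ?ltn_add2l//.
by rewrite addnC -mulSn mulnC leq_mul2l nm orbT.
Qed.

End Paths.

(** * Consequences of independence and of equality in law *)

Section Iid.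
Context (d : measure_display) (T : measurableType d) (R : realType)
  (Pr : probability T R).
Implicit Types (X : {RV Pr >-> R}) (I : choiceType).

(** Serves to extract from the array [W] the sequence of one worker, or one mini-batch of every
    worker. *)
Lemma iid_copies_reindex X I (K : choiceType) (f : K -> I)
    (Y : I -> {RV Pr >-> R}) :
  injective f -> iid_copies X Y -> iid_copies X (Y \o f).
Proof.
move=> injf [indY distY]; split=> [F B mB|k]; last exact: distY.
(* The family [B] is transported along [f] and completed by [setT] off the image; injectivity of [f]
   gives [C (f k) = B k]. *)
pose C i := if pselect (exists k, f k = i) is left h then B (projT1 (cid h))
  else setT.
have Cf k : C (f k) = B k.
  rewrite /C; case: pselect => [h|[]]; last by exists k.
  by congr B; apply: injf; case: cid.
have mC i : measurable (C i) by rewrite /C; case: pselect.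
have := indY (f @` F)%fset C mC.
rewrite big_imfset/=; last by move=> ? ? _ _; exact: injf.
under eq_bigr do rewrite Cf; move=> <-; congr (Pr _).
apply/seteqP; split => w h.
  by move=> _ /= /imfsetP[k kF ->]; rewrite Cf; exact: h.
by move=> k kF; rewrite /= -Cf; apply: h => /=; apply/imfsetP; exists k.
Qed.

Lemma ge0_integral_same_distribution (Y X : {RV Pr >-> R}) (f : R -> \bar R) :
  same_distribution Y X -> measurable_fun setT f -> (forall y, 0 <= f y)%E ->
  (\int[Pr]_w f (Y w) = \int[Pr]_w f (X w))%E.
Proof.
move=> YX mf f0.
rewrite -(ge0_integral_distribution Y)// -(ge0_integral_distribution X)//.
by apply: eq_measure_integral => A mA _; exact: YX.
Qed.

(** Almost sure nonnegativity says that the law gives []-oo, 0[] no mass, so it passes between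
    variables with the same law. *)
Lemma iid_ge0 X I (Y : I -> {RV Pr >-> R}) i : iid_copies X Y ->
  {ae Pr, forall w, 0 <= X w} -> {ae Pr, forall w, 0 <= Y i w}.
Proof.
move=> [_ distY] X0.
have mB : measurable (`]-oo, 0[%classic : set R) by [].
have XN : Pr (X @^-1` `]-oo, 0[) = 0%E.
  case: X0 => N [mN muN XN]; apply: (subset_measure0 _ mN) => //.
    by rewrite -[_ @^-1` _]setTI; exact: measurable_funP.
  by move=> w /=; rewrite in_itv/= => Xw; apply: XN => /=; rewrite leNgt Xw.
exists (Y i @^-1` `]-oo, 0[); split.
- by rewrite -[_ @^-1` _]setTI; exact: measurable_funP.
- by have := distY i _ mB; rewrite /distribution/= /pushforward XN.
- by move=> w /= /negP; rewrite -ltNge in_itv.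
Qed.

Lemma iid_max_le X n (Y : 'I_n -> {RV Pr >-> R}) r : iid_copies X Y -> 0 <= r ->
  Pr [set w | \big[Num.max/0]_(i < n) Y i w <= r] =
  (\prod_(i < n) distribution Pr X `]-oo, r]%classic)%E.
Proof.
move=> [indY distY] r0.
have mB : measurable (`]-oo, r]%classic : set R) by [].
have := indY [fset i | i in 'I_n]%fset (fun=> `]-oo, r]%classic) (fun=> mB).
rewrite (perm_big (index_enum 'I_n)) /=; last first.
  apply: uniq_perm; [exact: fset_uniq|exact: index_enum_uniq|].
  by move=> i; rewrite mem_index_enum; apply/imfsetP; exists i.
under eq_bigr => i _ do rewrite [Pr _](distY i _ mB).
move=> <-; congr (Pr _); apply/seteqP; split => w /=.
  by move=> /bigmax_leP[_ h] i _ /=; rewrite in_itv/= h.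
move=> h; apply/bigmax_leP; split => // i _.
have /= := h i; rewrite in_itv/=; apply.
by apply/imfsetP; exists i.
Qed.

Lemma measurable_bigmax n (Y : 'I_n -> {RV Pr >-> R}) :
  measurable_fun setT (fun w => \big[Num.max/0]_(i < n) Y i w).
Proof.
elim: n Y => [|n IHn] Y.
  rewrite [X in measurable_fun _ X](_ : _ = cst 0)//.
  by apply/funext => w; rewrite big_ord0.
rewrite [X in measurable_fun _ X](_ : _ = Y ord0 \max
    (fun w => \big[Num.max/0]_(i < n) Y (lift ord0 i) w)).
  by apply: measurable_maxr => //; exact: (IHn (fun i => Y (lift ord0 i))).
by apply/funext => w; rewrite big_ord_recl.
Qed.

(** The mean of a nonnegative variable is the integral of its tail probability. For the maximum this
    tail is one minus a power of the distribution function of [X], whichever family is used. *)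
Lemma expectation_iid_max X n (Y Z : 'I_n -> {RV Pr >-> R}) :
  iid_copies X Y -> iid_copies X Z ->
  ('E_Pr[fun w => (\big[Num.max/0]_(i < n) Y i w)%R] =
   'E_Pr[fun w => (\big[Num.max/0]_(i < n) Z i w)%R])%E.
Proof.
move=> iidY iidZ.
have maxE (V : 'I_n -> {RV Pr >-> R}) : iid_copies X V ->
    ('E_Pr[fun w => (\big[Num.max/0]_(i < n) V i w)%R] =
    \int[@lebesgue_measure R]_(r in `[0%R, +oo[)
       (1 - \prod_(i < n) distribution Pr X `]-oo, r]%classic))%E.
  move=> iidV; pose M : {RV Pr >-> R} :=
    HB.pack (fun w => \big[Num.max/0]_(i < n) V i w)
      (isMeasurableFun.Build _ _ _ _ _ (measurable_bigmax V)).
  rewrite -[LHS]/('E_Pr[M])%E ge0_expectation_ccdf => [|w]; last first.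
    by rewrite /M/=; exact: bigmax_ge_id.
  apply: eq_integral => r; rewrite inE/= in_itv/= andbT => r0.
  rewrite -(iid_max_le iidV r0) -(cdf_ccdf_1 M r).
  by rewrite addeAC subee ?add0e// fin_num_measure.
by rewrite !maxE.
Qed.

(** The joint law of [Y i] and [Y j] agrees with the product of their laws on rectangles, hence
    everywhere, and Tonelli factors the integral. *)
Lemma expectation_indepM X I (Y : I -> {RV Pr >-> R}) i j (f g : R -> R) :
  iid_copies X Y -> i != j -> measurable_fun setT f -> measurable_fun setT g ->
  (forall y, 0 <= f y) -> (forall y, 0 <= g y) ->
  ('E_Pr[fun w => (f (Y i w) * g (Y j w))%R] =
  'E_Pr[fun w => f (Y i w)] * 'E_Pr[fun w => g (Y j w)])%E.
Proof.
move=> [indY _] ij mf mg f0 g0.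
pose mi := distribution Pr (Y i); pose mj := distribution Pr (Y j).
have mYij : measurable_fun setT (fun w => (Y i w, Y j w)).
  exact: measurable_fun_pair.
pose Yij : {RV Pr >-> (R * R)%type} :=
  HB.pack (fun w => (Y i w, Y j w)) (isMeasurableFun.Build _ _ _ _ _ mYij).
have prodE (A B : set R) : measurable A -> measurable B ->
    distribution Pr Yij (A `*` B) = (mi A * mj B)%E.
  move=> mA mB.
  have /= := indY [fset i; j]%fset (fun k => if k == i then A else B).
  rewrite big_fsetU1/= ?inE// big_seq_fset1 eqxx eq_sym (negbTE ij).
  rewrite /mi /mj /distribution /= /pushforward => <-; last first.
    by move=> k; case: ifP.
  congr (Pr _); apply/seteqP; split => w /=.
    by move=> [Aw Bw] k /=; rewrite !inE => /orP[]/eqP ->;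
      rewrite ?eqxx// eq_sym (negbTE ij).
  move=> h; split.
    by have /= := h i; rewrite eqxx; apply; rewrite !inE eqxx.
  have /= := h j; rewrite eq_sym (negbTE ij); apply.
  by rewrite !inE eqxx orbT.
pose fg (p : R * R) := (f p.1 * g p.2)%:E.
have mfg : measurable_fun setT fg.
  by apply/measurable_EFinP/measurable_funM;
    [exact: measurableT_comp|exact: measurableT_comp].
have fg0 p : (0 <= fg p)%E by rewrite lee_fin mulr_ge0.
rewrite !unlock.
transitivity (\int[distribution Pr Yij]_p fg p)%E.
  by rewrite ge0_integral_distribution.
transitivity (\int[(mi \x mj)%E]_p fg p)%E.
  apply: eq_measure_integral => A mA _; apply/esym.
  exact: (@product_measure_unique _ _ _ _ _ mi mj).
rewrite fubini_tonelli1// /fubini_F /fg/=.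
have mf' : measurable_fun setT (EFin \o f) by exact/measurable_EFinP.
have mg' : measurable_fun setT (EFin \o g) by exact/measurable_EFinP.
under eq_integral => x _.
  under eq_integral do rewrite EFinM.
  rewrite ge0_integralZl//;
    [|by move=> y _; rewrite lee_fin|by rewrite lee_fin].
  over.
rewrite ge0_integralZr//.
- rewrite (ge0_integral_distribution (Y i) (f := EFin \o f))//.
    by rewrite (ge0_integral_distribution (Y j) (f := EFin \o g)).
- by move=> y _; rewrite lee_fin.
- by apply: integral_ge0 => y _; rewrite lee_fin.
Qed.

End Iid.

(** * Weak law of large numbers in L1 *)

Section WeakLaw.
Context (d : measure_display) (T : measurableType d) (R : realType)
  (Pr : probability T R) (X : {RV Pr >-> R}) (Y : nat -> {RV Pr >-> R}).
Hypothesis iidY : iid_copies X Y.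

Lemma bounded_integrable (h : T -> R) (C : R) : measurable_fun setT h ->
  (forall w, `|h w| <= C) -> Pr.-integrable setT (EFin \o h).
Proof.
move=> mh hC; apply: measurable_bounded_integrable => //.
  by rewrite -ge0_fin_numE// fin_num_measure.
exists C; split => [|x Cx w _ /=]; first exact: num_real.
by rewrite (le_trans (hC w))// ltW.
Qed.

(** * Sums of a bounded transform [f] of the variables, later a truncation *)

Section Bounded.
Variables (f : R -> R) (M : R).
Hypotheses (mf : measurable_fun setT f) (f0 : forall y, 0 <= f y)
  (fM : forall y, f y <= M).

Let nu := fine ('E_Pr[f \o X])%E.

Let mfY j : measurable_fun setT (f \o Y j).
Proof. exact: measurableT_comp. Qed.

Let normfM y : `|f y| <= M. Proof. by rewrite ger0_norm. Qed.

Let EfY j : 'E_Pr[f \o Y j]%E = 'E_Pr[f \o X]%E.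
Proof.
rewrite !unlock.
apply: (@ge0_integral_same_distribution _ _ _ _ _ _ (EFin \o f)) => //.
- exact: iidY.2.
- exact/measurable_EFinP.
Qed.

Let LfY j : (f \o Y j) \in Lfun Pr 1.
Proof.
by apply/Lfun1_integrable; apply: (bounded_integrable (C := M)) => //= w.
Qed.

Lemma covariance_iid_bounded i j : i != j ->
  covariance Pr (f \o Y i) (f \o Y j) = 0%E.
Proof.
move=> ij; rewrite covarianceE//.
  rewrite (expectation_indepM iidY ij mf mf f0 f0) subee//.
  by rewrite fin_numM//; exact: expectation_fin_num (LfY _).
apply/Lfun1_integrable; apply: (bounded_integrable (C := M * M)).
  exact: (measurable_funM (mfY i) (mfY j)).
by move=> w; rewrite /= normrM; apply: ler_pM => //=.
Qed.

Let nu_ge0 : 0 <= nu.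
Proof. by rewrite fine_ge0// expectation_ge0// => w /=. Qed.

Let nu_leM : nu <= M.
Proof.
rewrite -lee_fin fineK -(EfY 0) ?expectation_fin_num//.
rewrite -(expectation_cst Pr M) expectation_le//.
- by move=> w /=.
- by move=> w /=; exact: le_trans (f0 0) (fM 0).
- by apply: aeW => w /=.
Qed.

Let V j w := f (Y j w) - nu.

Let mV j : measurable_fun setT (V j).
Proof. by apply: measurable_funB => //; exact: mfY. Qed.

Let normV j w : `|V j w| <= M.
Proof.
have := f0 (Y j w); have := fM (Y j w); have := nu_ge0; have := nu_leM.
by rewrite /V ler_norml => *; apply/andP; split; lra.
Qed.

(** In the expanded square the off-diagonal terms are covariances and vanish; each of the [m]
    diagonal terms is at most [M ^+ 2]. *)
Lemma second_moment_sum_iid_bounded m :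
  (\int[Pr]_w ((\sum_(j < m) (f (Y j w) - nu)) ^+ 2)%:E <=
  (m%:R * M ^+ 2)%:E)%E.
Proof.
have intVV i j : Pr.-integrable setT (fun w => (V i w * V j w)%:E).
  apply: (bounded_integrable (h := fun w => V i w * V j w) (C := M * M)).
    exact: measurable_funM.
  by move=> w; rewrite normrM; apply: ler_pM => //=.
have -> : (\int[Pr]_w ((\sum_(j < m) (f (Y j w) - nu)) ^+ 2)%:E =
    \sum_(i < m) \sum_(j < m) \int[Pr]_w (V i w * V j w)%:E)%E.
  under [RHS]eq_bigr => i _.
    rewrite -(@integral_sum _ _ _ Pr _ _ _
      (fun (j : 'I_m) w => (V i w * V j w)%:E))//.
    over.
  rewrite /=.
  rewrite -(@integral_sum _ _ _ Pr _ _ _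
      (fun (i : 'I_m) w => \sum_(j < m) (V i w * V j w)%:E)%E)//.
    apply: eq_integral => w _; rewrite expr2 mulr_suml -sumEFin.
    by apply: eq_bigr => i _; rewrite mulr_sumr -sumEFin.
  by move=> i; apply: integrable_sum.
have -> : (m%:R * M ^+ 2)%:E = (\sum_(i < m) (M ^+ 2)%:E)%E :> \bar R.
  by rewrite sumEFin sumr_const card_ord mulr_natl.
apply: lee_sum => i _; rewrite (bigD1 i)//= big1 ?adde0.
  rewrite -(expectation_cst Pr (M ^+ 2)) unlock; apply: ge0_le_integral => //.
  - by move=> w _; rewrite lee_fin -expr2 sqr_ge0.
  - exact/measurable_EFinP/measurable_funM.
  - exact/measurable_EFinP.
  - move=> w _; rewrite lee_fin /= -expr2 -(real_normK (num_real _)).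
    by rewrite lerXn2r ?nnegrE// (le_trans _ (fM 0)).
move=> j ji; have := @covariance_iid_bounded i j; rewrite eq_sym => /(_ ji).
by rewrite covariance.unlock !EfY -/nu expectation.unlock.
Qed.

(** An integrated form of Chebyshev's bound: pointwise [|s| <= a + s ^+ 2 / a], because
    [(|s| - a) ^+ 2 >= 0], and the second moment is already bounded. *)
Lemma L1_dist_sum_iid_bounded m (a : R) : 0 < a ->
  (\int[Pr]_w (`|\sum_(j < m) (f (Y j w) - nu)|)%:E <=
  (a + m%:R * M ^+ 2 / a)%:E)%E.
Proof.
move=> a0; pose S w := \sum_(j < m) V j w.
have mS : measurable_fun setT S by exact: measurable_sum.
have mS2 : measurable_fun setT (fun w => S w ^+ 2) by exact: measurable_funX.
apply: (@le_trans _ _ (\int[Pr]_w (a%:E + a^-1%:E * (S w ^+ 2)%:E))%E).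
  apply: ge0_le_integral => //.
  - exact/measurable_EFinP/measurableT_comp.
  - apply/measurable_EFinP; apply: measurable_funD => //.
    exact: measurable_funM.
  - move=> w _; rewrite -EFinM -EFinD lee_fin -/(S w).
    rewrite -(ler_pM2r a0) mulrDl mulrAC mulVf ?gt_eqF// mul1r.
    rewrite -(real_normK (num_real (S w))).
    have := sqr_ge0 (`|S w| - a); have := normr_ge0 (S w).
    by set s := `|S w|; nra.
rewrite ge0_integralD//; last 3 first.
- by move=> w _; rewrite lee_fin ltW.
- by move=> w _; rewrite -EFinM lee_fin mulr_ge0 ?sqr_ge0// invr_ge0 ltW.
- by apply/measurable_EFinP; exact: measurable_funM.
have /= := expectation_cst Pr a; rewrite expectation.unlock => ->.
rewrite EFinD leeD2l//.
rewrite ge0_integralZl_EFin//; last 3 first.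
- by move=> w _; rewrite lee_fin sqr_ge0.
- exact/measurable_EFinP.
- by rewrite invr_ge0 ltW.
rewrite mulrC EFinM lee_wpmul2l//.
  by rewrite lee_fin invr_ge0 ltW.
exact: second_moment_sum_iid_bounded.
Qed.

Hypothesis intX : Pr.-integrable setT (EFin \o X).

Let mu := fine ('E_Pr[X])%E.

(** The deviation splits into the centred truncated sum, the [m] truncation errors and [m] times the
    shift of the mean; the last two contribute [m e] each. *)
Lemma L1_dist_sum_iid_trunc m (a e : R) : 0 < a ->
  (\int[Pr]_w (`|X w - f (X w)|)%:E <= e%:E)%E ->
  (\int[Pr]_w (`|\sum_(j < m) Y j w - m%:R * mu|)%:E <=
  (a + m%:R * M ^+ 2 / a + m%:R * e + m%:R * e)%:E)%E.
Proof.
move=> a0 Xe; pose r y := `|y - f y|.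
have mr : measurable_fun setT r.
  by apply: measurableT_comp => //; exact: measurable_funB.
have intf : Pr.-integrable setT (EFin \o (f \o X)).
  by apply: (bounded_integrable (C := M)) => // [|w /=]//;
    exact: measurableT_comp.
have numu : `|nu - mu| <= e.
  rewrite -lee_fin (le_trans _ Xe)//.
  have -> : (`|nu - mu|%:E = `|\int[Pr]_w (f (X w) - X w)%:E|)%E.
    under eq_integral do rewrite EFinB.
    rewrite integralB// -abse_EFin EFinB !fineK ?unlock//.
      exact: integrable_fin_num.
    exact: integrable_fin_num.
  apply: le_trans (le_abse_integral _ _ _) _ => //.
    apply/measurable_EFinP; apply: measurable_funB => //.
    exact: measurableT_comp.
  by rewrite le_eqVlt; apply/orP; left; apply/eqP; apply: eq_integral => w _ /=;
    rewrite distrC.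
have mrY j : measurable_fun setT (fun w => (r (Y j w))%:E).
  by apply/measurable_EFinP; exact: measurableT_comp.
have mS : measurable_fun setT (fun w => (`|\sum_(j < m) V j w|)%:E).
  apply/measurable_EFinP; apply: measurableT_comp => //.
  exact: measurable_sum.
apply: (@le_trans _ _ (\int[Pr]_w ((`|\sum_(j < m) V j w|)%:E +
    \sum_(j < m) (r (Y j w))%:E + (m%:R * e)%:E))%E).
  apply: ge0_le_integral => //.
  - apply/measurable_EFinP; apply: measurableT_comp => //.
    apply: measurable_funB => //; exact: measurable_sum.
  - by apply: emeasurable_funD => //; apply: emeasurable_funD => //;
      exact: emeasurable_sum.
  - move=> w _; rewrite sumEFin -!EFinD lee_fin.
    have -> : \sum_(j < m) Y j w - m%:R * mu = \sum_(j < m) V j w +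
        \sum_(j < m) (Y j w - f (Y j w)) + m%:R * (nu - mu).
      rewrite /V !sumrB sumr_const card_ord -mulr_natl; lra.
    apply: le_trans (ler_normD _ _) _; apply: lerD; last first.
      by rewrite normrM ger0_norm// ler_wpM2l.
    apply: le_trans (ler_normD _ _) _; apply: lerD => //.
    exact: ler_norm_sum.
have e0 : 0 <= e by rewrite (le_trans _ numu).
rewrite ge0_integralD//; last 3 first.
- by move=> w _; rewrite adde_ge0// sume_ge0// => i _; rewrite lee_fin /r.
- by apply: emeasurable_funD => //; exact: emeasurable_sum.
- by move=> w _; rewrite lee_fin mulr_ge0.
have /= := expectation_cst Pr (m%:R * e); rewrite expectation.unlock => ->.
rewrite [leRHS]EFinD leeD2r// ge0_integralD//; last 2 first.
- by move=> w _; rewrite sume_ge0// => i _; rewrite lee_fin /r.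
- exact: emeasurable_sum.
rewrite EFinD; apply: leeD; first exact: L1_dist_sum_iid_bounded.
rewrite ge0_integral_sum//; last by move=> j w _; rewrite lee_fin /r.
have -> : (m%:R * e)%:E = (\sum_(i < m) e%:E)%E :> \bar R.
  by rewrite sumEFin sumr_const card_ord mulr_natl.
apply: lee_sum => j _; apply: le_trans Xe.
rewrite (@ge0_integral_same_distribution _ _ _ _ (Y j) X (EFin \o r))//.
- exact: iidY.2.
- exact/measurable_EFinP.
- by move=> y; rewrite lee_fin /r.
Qed.

End Bounded.

Hypothesis intX : Pr.-integrable setT (EFin \o X).
Hypothesis X0 : {ae Pr, forall w, 0 <= X w}.

Let clip (n : nat) (y : R) : R := Num.max 0 (Num.min y n%:R).

(** Dominated convergence with bound [|X|]: where [X w >= 0], the integrand is zero as soon as [n]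
    exceeds [X w]. *)
Lemma L1_dist_clip_cvg0 :
  (\int[Pr]_w (`|X w - clip n (X w)|)%:E @[n --> \oo] --> 0)%E.
Proof.
have mclip n : measurable_fun setT (clip n).
  by apply: measurable_maxr => //; exact: measurable_minr.
have := @dominated_convergence _ _ _ Pr setT measurableT
  (fun n w => (`|X w - clip n (X w)|)%:E) (cst 0%E) (fun w => `|X w|%:E).
rewrite integral0; case => //.
- move=> n; apply/measurable_EFinP; apply: measurableT_comp => //.
  by apply: measurable_funB => //; exact: measurableT_comp.
- apply: filterS X0 => w Xw _; apply: cvg_near_cst.
  exists (Num.truncn (X w)).+1 => // n /= Xn.
  have Xn' : X w <= n%:R.
    by rewrite (le_trans (ltW (truncnS_gt _)))// ler_nat.
  by rewrite /clip min_l// max_r// subrr normr0.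
- by have := integrable_abse intX.
- apply: aeW => w n _ /=; rewrite lee_fin normr_id /clip.
  have n0 : 0 <= n%:R :> R by [].
  rewrite maxEle minEle; case: (leP (X w) n%:R) => Xn.
    by case: (leP 0 (X w)) => Xw; rewrite ?subrr ?subr0 ?normr0.
  by rewrite n0 !ger0_norm; lra.
Qed.

Lemma L1_weak_law (e : R) : 0 < e -> \forall m \near \oo,
  (\int[Pr]_w (`|\sum_(j < m) Y j w - m%:R * fine ('E_Pr[X])%E|)%:E <=
  (m%:R * e)%:E)%E.
Proof.
(* The four terms of the truncation bound each receive a quarter of [m e]. The level [n] is fixed
   first, and [m] is taken large afterwards. *)
move=> e0; have e4 : 0 < e / 4 by lra.
have /fine_cvgP[fin1 /cvgrPdist_le/(_ _ e4) cl] := L1_dist_clip_cvg0.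
near \oo => n.
have Xe : (\int[Pr]_w (`|X w - clip n (X w)|)%:E <= (e / 4)%:E)%E.
  rewrite -[leLHS]fineK; last by near: n.
  rewrite lee_fin (le_trans (ler_norm _))//.
  by rewrite -normrN -sub0r; near: n.
have mclip : measurable_fun setT (clip n).
  by apply: measurable_maxr => //; exact: measurable_minr.
near=> m.
have m0 : (0 < m)%N by near: m; exact: nbhs_infty_gt.
have m0R : 0 < m%:R :> R by rewrite ltr0n.
(* With [a = m e / 4] the variance term becomes [n^2 / (e / 4)], which is free of [m] and so at most
   [m e / 4] for large [m]. *)
have a0 : 0 < m%:R * (e / 4) by rewrite mulr_gt0.
apply: le_trans
  (@L1_dist_sum_iid_trunc (clip n) n%:R mclip _ _ intX m _ _ a0 Xe) _.
- by move=> y; rewrite /clip le_max lexx.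
- by move=> y; rewrite /clip ge_max ler0n ge_min lexx orbT.
rewrite lee_fin.
suff : m%:R * n%:R ^+ 2 / (m%:R * (e / 4)) <= m%:R * (e / 4) by lra.
rewrite -mulf_div divff ?gt_eqF// mul1r ler_pdivrMr//.
rewrite -mulrA -ler_pdivrMr ?mulr_gt0//.
by near: m; exact: nbhs_infty_ger.
Unshelve. all: by end_near. Qed.

End WeakLaw.

(** * Limit of the asynchronous mean runtime *)

Section AsyncLimit.
Context (d : measure_display) (T : measurableType d) (R : realType)
  (Pr : probability T R).

(** As [f] may be nonmeasurable, it is only compared with the measurable functions [c + D] and
    [max(0, c - D)], and additivity is applied to those. *)
Lemma expectation_dist_le (f D : T -> R) (c e : R) :
  (forall w, 0 <= f w) -> 0 <= c -> measurable_fun setT D ->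
  (forall w, 0 <= D w) -> {ae Pr, forall w, `|f w - c| <= D w} ->
  (\int[Pr]_w (D w)%:E <= e%:E)%E ->
  exists2 s : R, 'E_Pr[f]%E = s%:E & `|s - c| <= e.
Proof.
move=> f0 c0 mD D0 fD De.
have mDE : measurable_fun setT (fun w => (D w)%:E) by exact/measurable_EFinP.
have cE : (\int[Pr]_w c%:E = c%:E)%E.
  by have /= := expectation_cst Pr c; rewrite expectation.unlock.
have up : ('E_Pr[f] <= (c + e)%:E)%E.
  rewrite unlock; apply: (@le_trans _ _ (\int[Pr]_w (c%:E + (D w)%:E))%E).
    apply: ae_ge0_le_integral_nonmeas => [w|w|].
    - by rewrite lee_fin.
    - by rewrite lee_fin addr_ge0.
    - apply: filterS fD => w; rewrite ler_distl => /andP[_].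
      by rewrite lee_fin.
  rewrite ge0_integralD//; last by move=> w _; rewrite lee_fin.
  by rewrite cE EFinD leeD2l.
(* Cutting [c - D] at 0 makes it nonnegative, keeps it below [f] almost surely, and preserves
   [c <= g + D]. *)
pose g w := Num.max 0 (c - D w).
have mg : measurable_fun setT g.
  by apply: measurable_maxr => //; exact: measurable_funB.
have lo : (c%:E <= 'E_Pr[f] + e%:E)%E.
  apply: (@le_trans _ _ (\int[Pr]_w (g w)%:E + \int[Pr]_w (D w)%:E)%E).
    rewrite -ge0_integralD//; last 3 first.
    - by move=> w _; rewrite lee_fin /g le_max lexx.
    - exact/measurable_EFinP.
    - by move=> w _; rewrite lee_fin.
    rewrite -[leLHS]cE; apply: ae_ge0_le_integral_nonmeas => [w|w|].
    - by rewrite lee_fin.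
    - by rewrite lee_fin addr_ge0// /g le_max lexx.
    - by apply: aeW => w; rewrite lee_fin -lerBlDr /g le_max lexx orbT.
  apply: leeD => //; rewrite unlock.
  apply: ae_ge0_le_integral_nonmeas => [w|w|].
  - by rewrite lee_fin /g le_max lexx.
  - by rewrite lee_fin.
  - apply: filterS fD => w; rewrite ler_distl => /andP[fl _].
    by rewrite lee_fin /g ge_max f0.
have fin : 'E_Pr[f]%E \is a fin_num.
  by rewrite ge0_fin_numE ?expectation_ge0// (le_lt_trans up)// ltry.
exists (fine 'E_Pr[f]%E); first by rewrite fineK.
move: up lo; rewrite -(fineK fin) -EFinD !lee_fin /= => up lo.
by rewrite ler_distl; apply/andP; split; lra.
Qed.

Context (P : nat) (X : {RV Pr >-> R}) (W : 'I_P * nat -> {RV Pr >-> R}).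
Hypotheses (P0 : (0 < P)%N) (iidW : iid_copies X W)
  (intX : Pr.-integrable setT (EFin \o X))
  (X0 : {ae Pr, forall w, 0 <= X w}).

Let mu := fine ('E_Pr[X])%E.

Let mu_ge0 : 0 <= mu.
Proof.
apply: fine_ge0; rewrite unlock.
rewrite (@ae_eq_integral_nonmeas _ _ _ Pr _ (fun w => `|X w|%:E)).
  by apply: integral_ge0 => w _; rewrite lee_fin.
by apply: filterS X0 => w Xw; rewrite ger0_norm.
Qed.

Lemma async_update_time_ge0 (x : 'I_P -> nat -> R) J :
  0 <= async_update_time x J.
Proof.
rewrite /async_update_time; set A := (X in inf X).
have [A0|/set0P A0] := eqVneq A set0; first by rewrite A0 inf0.
by apply: lb_le_inf => // t [].
Qed.

Lemma expectation_async_update_time (e : R) : 0 < e -> \forall J \near \oo,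
  exists2 s : R,
    'E_Pr[fun w => async_update_time (fun i j => W (i, j) w) J]%E = s%:E &
    `|s - (J.-1 %/ P).+1%:R * mu| <= P%:R * ((J.-1 %/ P).+1%:R * e).
Proof.
move=> e0; pose Y i j := W (i, j).
have iidY i : iid_copies X (Y i).
  by apply: (iid_copies_reindex (f := pair i)) iidW => j k [].
have /filter_forall[N _ NP] : forall i : 'I_P, \forall m \near \oo,
    (\int[Pr]_w (`|\sum_(j < m) Y i j w - m%:R * mu|)%:E <= (m%:R * e)%:E)%E.
  by move=> i; exact: L1_weak_law.
(* From this threshold on, [J.-1 %/ P >= N], so the weak law applies to all workers at [m]. *)
exists (N * P).+1 => // J /= NJ; set m := (J.-1 %/ P).+1.
have J0 : (0 < J)%N by exact: leq_trans NJ.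
have Nm : (N <= m)%N.
  by rewrite ltnW// ltnS leq_divRL// -ltnS prednK.
have W0 : {ae Pr, forall w i j, 0 <= W (i, j) w}.
  apply: filter_forall => i; apply: ae_foralln => j.
  exact: iid_ge0 iidW X0.
pose dist i w := `|\sum_(j < m) Y i j w - m%:R * mu|.
have mdist i : measurable_fun setT (dist i).
  apply: measurableT_comp => //; apply: measurable_funB => //.
  by apply: measurable_sum.
(* The sum of the workers' deviations dominates each of them, so it can be the radius in the
   pathwise bound; its mean is at most [P] times the weak-law error. *)
apply: (@expectation_dist_le _ (fun w => \sum_(i < P) dist i w)).
- by move=> w; exact: async_update_time_ge0.
- by rewrite mulr_ge0.
- exact: measurable_sum.
- by move=> w; apply: sumr_ge0 => i _; exact: normr_ge0.
(* [push_time] at index [J.-1 %/ P] sums exactly [m] terms, its indices being counted from 0. *)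
- apply: filterS W0 => w W0; apply: async_update_time_dist => // i.
  by rewrite (bigD1 i)//= lerDl sumr_ge0// => k _; exact: normr_ge0.
- under eq_integral do rewrite -sumEFin.
  rewrite ge0_integral_sum//; last by move=> i w _; rewrite lee_fin /dist.
    have -> : (P%:R * (m%:R * e))%:E = (\sum_(i < P) (m%:R * e)%:E)%E :> \bar R.
      by rewrite sumEFin sumr_const card_ord mulr_natl.
    by apply: lee_sum => i _; exact: NP.
  by move=> i; exact/measurable_EFinP.
Qed.

(** Since [J <= m P <= J + P], replacing [m E[X]] by [J E[X] / P] costs at most [E[X]], which is
    negligible after division by [J]. *)
Lemma cvg_async_mean_runtime :
  async_mean_runtime W @ \oo --> (mu / P%:R)%:E.
Proof.
have PR : 0 < P%:R :> R by rewrite ltr0n.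
have key (e : R) : 0 < e -> \forall J \near \oo,
    exists2 s, async_mean_runtime W J = s%:E & `|mu / P%:R - s| <= e.
  (* Summed over the [P] workers this tolerance gives [m e / 4], at most [J e / 2] as [m <= 2 J];
     the other [J e / 2] absorbs the rounding error [mu]. *)
  move=> e0; have e1 : 0 < e / (4 * P%:R) by rewrite divr_gt0// mulr_gt0.
  near=> J.
  have J0 : (0 < J)%N by near: J; exact: nbhs_infty_gt.
  have JR : 1 <= J%:R :> R by rewrite ler1n.
  have muJ : 2 * mu / e <= J%:R by near: J; exact: nbhs_infty_ger.
  have [s sE] : exists2 s : R,
      'E_Pr[fun w => async_update_time (fun i j => W (i, j) w) J]%E = s%:E &
      `|s - (J.-1 %/ P).+1%:R * mu| <=
        P%:R * ((J.-1 %/ P).+1%:R * (e / (4 * P%:R))).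
    by near: J; exact: expectation_async_update_time.
  set m := (J.-1 %/ P).+1 => sm.
  exists (s / J%:R).
    by rewrite /async_mean_runtime sE inver gt_eqF// (lt_le_trans _ JR).
  have Jm : J%:R <= m%:R * P%:R :> R.
    by rewrite -natrM ler_nat -[leqLHS]prednK// ltn_ceil.
  have mJ : m%:R * P%:R <= J%:R + P%:R :> R.
    rewrite -natrM -natrD ler_nat mulSn addnC leq_add2r.
    by rewrite (leq_trans (leq_trunc_div _ _))// leq_pred.
  have PR1 : 1 <= P%:R :> R by rewrite ler1n.
  have JR0 : 0 < J%:R :> R by exact: lt_le_trans JR.
  (* [J + P <= 2 J P], because [J] and [P] are both at least 1. *)
  have m2J : m%:R <= 2 * J%:R :> R.
    rewrite -(ler_pM2r PR) (le_trans mJ)//.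
    by nra.
  have {}muJ : 2 * mu <= J%:R * e by rewrite -ler_pdivrMr.
  have {}sm : `|s - m%:R * mu| <= m%:R * e / 4.
    apply: le_trans sm _; rewrite le_eqVlt; apply/orP; left; apply/eqP.
    by field; rewrite gt_eqF.
  have muP : `|mu / P%:R * J%:R - m%:R * mu| <= mu.
    have -> : mu / P%:R * J%:R - m%:R * mu =
        mu / P%:R * (J%:R - m%:R * P%:R) by field; rewrite gt_eqF.
    rewrite normrM ger0_norm ?divr_ge0// mulrAC ler_pdivrMr// ler_wpM2l//.
    by rewrite ler_norml; apply/andP; split; lra.
  rewrite -(ler_pM2r JR0) -[X in `|_| * X]gtr0_norm//.
  rewrite -normrM mulrBl divfK ?gt_eqF//.
  apply: le_trans (ler_distD (m%:R * mu) _ _) _.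
  rewrite distrC in sm; apply: le_trans (lerD muP sm) _.
  have : m%:R * e <= 2 * J%:R * e by rewrite ler_pM2r.
  by lra.
apply/fine_cvgP; split.
  by apply: filterS (key 1 ltr01) => J [s -> _].
apply/cvgrPdist_le => e e0.
by apply: filterS (key e e0) => J [s /= -> ].
Unshelve. all: by end_near. Qed.

End AsyncLimit.

(** * The quotient of the two expected runtimes *)

Theorem theorem1 (R : realType) (d : measure_display) (T : measurableType d)
    (Pr : probability T R) (P : nat) (hP : (1 <= P)%N)
    (X : {RV Pr >-> R})
    (Xpos : {ae Pr, forall w, 0 < X w})
    (EXpos : (0 < 'E_Pr[X])%E) (EXfin : ('E_Pr[X] < +oo)%E)
    (W : 'I_P * nat -> {RV Pr >-> R}) (Wiid : iid_copies X W)
    (Xs : 'I_P -> {RV Pr >-> R}) (Xsiid : iid_copies X Xs) :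
  cvgn (async_mean_runtime W) /\
  forall k : nat,
    ('E_Pr[fun w => sync_iteration (fun i j => W (i, j) w) k]
       / limn (async_mean_runtime W)
     = P%:R%:E * ('E_Pr[fun w => order_stat (fun i => Xs i w) P]
       / 'E_Pr[X]))%E.
Proof.
have X0 : {ae Pr, forall w, 0 <= X w} by apply: filterS Xpos => w /ltW.
have intX : Pr.-integrable setT (EFin \o X).
  apply/integrableP; split; first exact/measurable_EFinP.
  rewrite (@ae_eq_integral_nonmeas _ _ _ Pr _ (EFin \o X)).
    by have := EXfin; rewrite expectation.unlock.
  by apply: filterS X0 => w Xw /=; rewrite ger0_norm.
have cvgW := cvg_async_mean_runtime hP Wiid intX X0.
split => [|k]; first by apply/cvg_ex; eexists; exact: cvgW.
rewrite (cvg_lim _ cvgW)//.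
have syncE : ('E_Pr[fun w => sync_iteration (fun i j => W (i, j) w) k] =
    'E_Pr[fun w => (\big[Num.max/0]_(i < P) W (i, k) w)%R])%E.
  by congr expectation; apply/funext => w; rewrite sync_iterationE.
have Wkiid : iid_copies X (fun i => W (i, k)).
  by apply: (iid_copies_reindex (f := pair^~ k)) Wiid => i j [].
have statE : ('E_Pr[fun w => order_stat (fun i => Xs i w) P] =
    'E_Pr[fun w => (\big[Num.max/0]_(i < P) Xs i w)%R])%E.
  (* The order statistic equals the maximum with default 0 only where all [Xs i] are nonnegative,
     that is, up to a null set. *)
  rewrite expectation.unlock; apply: ae_eq_integral_nonmeas.
  have : {ae Pr, forall w i, 0 <= Xs i w}.
    by apply: filter_forall => i; exact: iid_ge0 Xsiid X0.
  by apply: filterS => w Xs0; rewrite order_stat_max.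
rewrite syncE statE (expectation_iid_max Wkiid Xsiid).
have EX : 'E_Pr[X]%E = (fine 'E_Pr[X])%:E.
  by rewrite fineK// ge0_fin_numE// ltW.
have mu0 : 0 < fine 'E_Pr[X]%E by rewrite -lte_fin -EX.
have PR : 0 < P%:R :> R by rewrite ltr0n.
(* Both denominators are positive reals, so their extended inverses are real ones; the mean of the
   maximum stays an extended real. *)
rewrite [in RHS]EX !inver !gt_eqF ?divr_gt0// invf_div EFinM.
by rewrite muleCA.
Qed.
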